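(* Consider the semi-discrete compressible Navier--Stokes equations on a hexahedral element with a solid wall on the face $x_1=0$, as described in the context, and impose the wall conditions through the viscous penalty $g^{(B,V),q}+\mathcal{L}^{(B,V)}$ on the conserved variables (with no dissipation term, $\mathcal{M}^{(B,V)}=0$), together with the penalty $g^{(B),\Theta}$ on the gradient of the entropy variables. These viscous penalty terms are 1. entropy conservative if the wall is adiabatic, i.e. $\mathtt{g}(t)=0$: the viscous wall contribution $\Xi^{V}$ to the semi-discrete entropy balance is zero, for every numerical solution; 2. entropy stable in the presence of a heat flux, i.e. $\mathtt{g}(t)\neq0$, where $\mathtt{g}(t)$ is a given $L^2$ function: the viscous wall contribution $\Xi^{V}$ is a function of the data $\mathtt{g}(t)$ only (it does not depend on the numerical solution).
   Context: **State and entropy variables.** Primitive variables $v=(\rho,\mathcal{U}_1,\mathcal{U}_2,\mathcal{U}_3,\mathcal{T})^\top$ with $\rho>0,\ \mathcal{T}>0$. Constants $R>0$, $c_{\mathcal P}>R$, $\gamma=c_{\mathcal P}/(c_{\mathcal P}-R)$, $\rho_\infty,\mathcal{T}_\infty>0$; $s=\frac{R}{\gamma-1}\log(\mathcal{T}/\mathcal{T}_\infty)-R\log(\rho/\rho_\infty)$; entropy function $\mathcal{S}=-\rho s$. Entropy variables as a function of $v$: $$W(v)=\Big(c_{\mathcal P}-s-\tfrac{\mathcal{U}^\top\mathcal{U}}{2\mathcal{T}},\ \tfrac{\mathcal{U}_1}{\mathcal{T}},\ \tfrac{\mathcal{U}_2}{\mathcal{T}},\ \tfrac{\mathcal{U}_3}{\mathcal{T}},\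 -\tfrac1{\mathcal{T}}\Big)^\top .$$ $\frac{\partial W}{\partial V}(v)$ denotes its (invertible) $5\times5$ Jacobian and $\frac{\partial V}{\partial W}(v)$ the inverse of that Jacobian. **Viscous flux.** With viscosity $\mu=\mu(\mathcal{T})>0$ and conductivity $\kappa=\kappa(\mathcal{T})>0$, the viscous flux in direction $x_m$ is $$\mathcal{F}^{(V)}_{x_m}=\Big(0,\tau_{1,m},\tau_{2,m},\tau_{3,m},\sum_{i}\tau_{i,m}\,\mathcal{U}_i+\kappa\frac{\partial\mathcal{T}}{\partial x_m}\Big)^\top,\quad \tau_{i,j}=\mu\Big(\frac{\partial\mathcal{U}_i}{\partial x_j}+\frac{\partial\mathcal{U}_j}{\partial x_i}-\frac23\delta_{i,j}\sum_n\frac{\partial\mathcal{U}_n}{\partial x_n}\Big).$$ The $5\times5$ matrices $C_{m,j}(v)$ are defined by $\mathcal{F}^{(V)}_{x_m}=\sum_{j=1}^3C_{m,j}(v)\,\theta_j$, where the right-hand side holds for all $\theta_1,\theta_2,\theta_3\in\mathbb{R}^5$ when the flux is evaluated at state $v$ with primitive-variable gradients $\partial v/\partial x_j=\frac{\partial V}{\partial W}(v)\,\theta_j$. **Semi-discretization.** The element is a tensor-product of Legendre--Gauss--Lobatto nodes with a diagonal-norm summation-by-parts operator with positive diagonal weights $\mathsf{P}$; $\mathsf{P}_{x_2,x_3}$ denotes the positive diagonal face quadrature weights. The conserved variables (with entropy variables $w=W(v)$ at each node) and the discrete entropy-variable gradients $\Theta_{x_j}$, $j=1,2,3$, solve a local-discontinuous-Galerkin-type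 system in which simultaneous-approximation-term penalties are added to the evolution equation ($g^{(B),q}$) and to the gradient equation $\Theta_{x_m}-\mathsf{D}_{x_m}w=\mathsf{P}_{x_m}^{-1}g_{x_m}^{(B),\Theta}$. Only the wall face $x_1=0$ is considered (outward normal $(-1,0,0)^\top$); the contributions of the other faces and of interfaces are neglected. Contracting the evolution equation with $w^\top\mathsf{P}$ and the gradient equations with $(\sum_jC_{m,j}\Theta_{x_j})^\top\mathsf{P}$ gives the discrete entropy balance $$\frac{d}{dt}\mathbf{1}^\top\widehat{\mathsf{P}}\,\mathcal{S}+\mathbf{DT}=\Xi^{I}+\Xi^{V},$$ where $\mathbf{1}^\top\widehat{\mathsf P}\mathcal S$ is the discrete integral of the entropy function, $\mathbf{DT}\ge0$ is the quadratic viscous dissipation in $\Theta$, $\Xi^I$ collects the inviscid wall terms (the entropy flux and the inviscid penalty, treated separately), and the viscous wall contribution is $$\Xi^{V}=\sum_{a}\mathsf{P}_a\Big[-w^\top f^{V}+w^\top\big(g^{(B,V),q}+\mathcal{L}^{(B,V)}\big)+(f^{V})^\top g^{(B),\Theta}\Big]_a,\qquad f^{V}=\sum_{j=1}^3C_{1,j}(v)\,\Theta_{x_j},$$ the sum being over the nodes $a$ of the wall face, with positive face weights $\mathsf{P}_a$. **Penalty terms at a wall node.** Given the wall velocity $(0,\mathcal{U}_2^{wall},\mathcal{U}_3^{wall})$, define the boundary state $$v^{(B,V)}=(\rho,\,-\mathcal{U}_1,\,-\mathcal{U}_2+2\mathcal{U}_2^{wall},\,-\mathcal{U}_3+2\mathcal{U}_3^{wall},\,\mathcal{T})^\top,\qquad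 w^{(B,V)}=W(v^{(B,V)}).$$ Boundary gradients: $\Pi_{x_j}=\frac{\partial V}{\partial W}(v)\,\Theta_{x_j}$, $\ \Pi^{(B,V)}_{x_j}=\mathrm{diag}(-1,1,1,1,-1)\,\Pi_{x_j}$, $\ \Theta^{(B,V)}_{x_j}=\frac{\partial W}{\partial V}(v^{(B,V)})\,\Pi^{(B,V)}_{x_j}$, $j=1,2,3$. Boundary viscous flux: $f^{(B,V)}=\sum_{j=1}^3C_{1,j}(v^{(B,V)})\,\Theta^{(B,V)}_{x_j}$. Then $$g^{(B,V),q}=\tfrac12\big(f^{V}-f^{(B,V)}\big),\qquad g^{(B),\Theta}=\tfrac12\big(w-w^{(B,V)}\big),\qquad \mathcal{L}^{(B,V)}=-(0,0,0,0,1)^\top\,\mathcal{T}\,\mathtt{g}(t),$$ where $\mathtt{g}(t)$ is the prescribed wall heat entropy flow (data for $\kappa\frac{\partial\mathcal{T}}{\partial x_1}\frac1{\mathcal{T}}$ at the wall), independent of the numerical solution. *)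

(* Defs.v *)
From HB Require Import structures.
From mathcomp Require Import all_boot all_order all_algebra.
From mathcomp Require Import all_classical all_reals all_analysis.
From mathcomp Require Import ring lra.

Set Implicit Arguments.
Unset Strict Implicit.
Unset Printing Implicit Defensive.

Import Order.TTheory GRing.Theory Num.Theory.
Import numFieldNormedType.Exports.

Local Open Scope classical_set_scope.
Local Open Scope ring_scope.

Section State.
Context {R : realType}.

(* All states are columns of R^5; index 0 is the density, 1, 2, 3 the velocity
   and 4 the temperature.  Space directions x_1, x_2, x_3 are indexed by 'I_3,
   so x_1 is direction ord0. *)
Definition vec5 (a : R) (b : 'I_3 -> R) (c : R) : 'cV[R]_5 :=
  \col_(i < 5) if (i == 0 :> nat)%N then a
               else if (i == 4 :> nat)%N then c
               else b (inord i.-1).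

Definition rho (v : 'cV[R]_5) : R := v (inord 0) 0.
Definition vel (v : 'cV[R]_5) (i : 'I_3) : R := v (inord i.+1) 0.
Definition temp (v : 'cV[R]_5) : R := v (inord 4) 0.

Definition dot5 (a b : 'cV[R]_5) : R := \sum_(i < 5) a i 0 * b i 0.

Definition admissible (v : 'cV[R]_5) : Prop := 0 < rho v /\ 0 < temp v.

(* Column convention: entry (i, j) is the partial derivative of the i-th
   component of f with respect to the j-th variable. *)
Definition jacobian5 (f : 'cV[R]_5 -> 'cV[R]_5) (v : 'cV[R]_5) : 'M[R]_5 :=
  \matrix_(i < 5, j < 5) 'D_(delta_mx j 0) (fun u => f u i 0 : R) v.

End State.

Record fluid (R : realType) := Fluid {
  Rg : R;
  cP : R;
  rho_inf : R;
  T_inf : R;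
  mu : R -> R;
  kappa : R -> R;
  Rg_gt0 : 0 < Rg;
  cP_gtRg : Rg < cP;
  rho_inf_gt0 : 0 < rho_inf;
  T_inf_gt0 : 0 < T_inf;
  mu_gt0 : forall T, 0 < T -> 0 < mu T;
  kappa_gt0 : forall T, 0 < T -> 0 < kappa T
}.

Section Physics.
Context {R : realType} (fl : fluid R).
Implicit Types (v : 'cV[R]_5) (G : 'I_3 -> 'cV[R]_5) (m i j : 'I_3).

Definition gamma : R := cP fl / (cP fl - Rg fl).

Definition thermo_entropy v : R :=
  Rg fl / (gamma - 1) * ln (temp v / T_inf fl)
  - Rg fl * ln (rho v / rho_inf fl).

Definition entropy_function v : R := - (rho v * thermo_entropy v).

(* Density, momentum and total energy; R / (gamma - 1) is the specific heat at
   constant volume. *)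
Definition conserved v : 'cV[R]_5 :=
  vec5 (rho v) (fun i => rho v * vel v i)
       (rho v * (Rg fl / (gamma - 1) * temp v
                 + (\sum_(i < 3) vel v i ^+ 2) / 2)).

Definition entropy_vars v : 'cV[R]_5 :=
  vec5 (cP fl - thermo_entropy v - (\sum_(i < 3) vel v i ^+ 2) / (2 * temp v))
       (fun i => vel v i / temp v)
       (- (temp v)^-1).

Definition dWdV v : 'M[R]_5 := jacobian5 entropy_vars v.
Definition dVdW v : 'M[R]_5 := invmx (dWdV v).

(* G j is the gradient of the primitive variables in direction x_j. *)
Definition stress v G i j : R :=
  mu fl (temp v) *
  (vel (G j) i + vel (G i) j
   - 2 / 3 * (i == j)%:R * \sum_(n < 3) vel (G n) n).

Definition viscous_flux v G m : 'cV[R]_5 :=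
  vec5 0 (fun i => stress v G i m)
       (\sum_(i < 3) stress v G i m * vel v i
        + kappa fl (temp v) * temp (G m)).

(* The defining property of the coefficient matrices C_{m,j}(v); it determines
   them at every admissible state. *)
Definition viscous_coefficients (C : 'I_3 -> 'I_3 -> 'cV[R]_5 -> 'M[R]_5)
    : Prop :=
  forall v, admissible v -> forall m (theta : 'I_3 -> 'cV[R]_5),
    viscous_flux v (fun j => dVdW v *m theta j) m
    = \sum_(j < 3) C m j v *m theta j.

End Physics.

Section Element.
Context {R : realType}.

(* Rodrigues' formula. *)
Definition legendre (n : nat) : {poly R} :=
  ((2 ^ n * n`!)%N%:R)^-1 *: (('X^2 - 1) ^+ n)^`(n).

(* The N + 1 Legendre-Gauss-Lobatto nodes on [a, b], in increasing order: the
   zeros of (1 - xi^2) P_N'(xi) after the affine map of [a, b] onto [-1, 1]. *)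
Definition lgl_nodes (N : nat) (a b : R) (x : 'I_N.+1 -> R) : Prop :=
  (forall i j : 'I_N.+1, (i < j)%N -> x i < x j) /\
  (forall i, root ((1 - 'X^2) * (legendre N)^`())
                  ((2 * x i - a - b) / (b - a))).

(* Diagonal-norm summation-by-parts operator of degree N on the nodes x; the
   norm matrix is diag_mx P. *)
Definition sbp_operator (N : nat) (x : 'I_N.+1 -> R)
    (P : 'rV[R]_N.+1) (D : 'M[R]_N.+1) : Prop :=
  [/\ forall i, 0 < P 0 i,
      forall (p : {poly R}) (i : 'I_N.+1), (size p <= N.+1)%N ->
        \sum_(l < N.+1) D i l * p.[x l] = p^`().[x i] &
      diag_mx P *m D + (diag_mx P *m D)^T
      = delta_mx ord_max ord_max - delta_mx ord0 ord0].

End Element.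

(* Tensor-product hexahedral element with its face x_1 = 0 on the wall. *)
Record element (R : realType) (N : nat) := Element {
  lo : 'I_3 -> R;
  hi : 'I_3 -> R;
  xnode : 'I_3 -> 'I_N.+1 -> R;
  P1d : 'I_3 -> 'rV[R]_N.+1;
  D1d : 'I_3 -> 'M[R]_N.+1;
  lo_wall : lo ord0 = 0;
  lo_lt_hi : forall m, lo m < hi m;
  xnode_lgl : forall m, lgl_nodes (lo m) (hi m) (xnode m);
  D1d_sbp : forall m, sbp_operator (xnode m) (P1d m) (D1d m)
}.

Section Discretization.
Context {R : realType} {N : nat} (E : element R N).

(* A node is a triple of one-dimensional node indices. *)
Definition node := {ffun 'I_3 -> 'I_N.+1}.
Definition nodal_field := node -> 'cV[R]_5.

Definition on_wall (k : node) : bool := k ord0 == ord0.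

Definition set_coord (k : node) (m : 'I_3) (l : 'I_N.+1) : node :=
  [ffun n => if n == m then l else k n].

Definition D_apply (m : 'I_3) (u : nodal_field) : nodal_field := fun k =>
  \sum_(l < N.+1) D1d E m (k m) l *: u (set_coord k m l).

Definition vol_weight (k : node) : R := \prod_(m < 3) P1d E m 0 (k m).

(* The quadrature weight of the faces normal to x_m; on the wall, m = ord0,
   this is P_{x_2, x_3}. *)
Definition face_weight (m : 'I_3) (k : node) : R :=
  \prod_(n < 3 | n != m) P1d E n 0 (k n).

(* P_{x_m}^{-1} applied to a penalty living on the wall face. *)
Definition wall_lift (g : nodal_field) : nodal_field := fun k =>
  if on_wall k then (P1d E ord0 0 (k ord0))^-1 *: g k else 0.

Context (fl : fluid R) (C : 'I_3 -> 'I_3 -> 'cV[R]_5 -> 'M[R]_5).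

Definition disc_flux (v : nodal_field) (Theta : 'I_3 -> nodal_field) (m : 'I_3)
    : nodal_field :=
  fun k => \sum_(j < 3) C m j (v k) *m Theta j k.

Section Wall.
(* uw k i is the velocity of the wall at the wall node k; only its tangential
   components i = 1, 2 are used. *)
Context (uw : node -> 'I_3 -> R) (g : R)
        (v : nodal_field) (Theta : 'I_3 -> nodal_field).

Definition v_bnd : nodal_field := fun k =>
  vec5 (rho (v k))
       (fun i => if i == ord0 then - vel (v k) i
                 else - vel (v k) i + 2 * uw k i)
       (temp (v k)).

Definition w_int : nodal_field := fun k => entropy_vars fl (v k).
Definition w_bnd : nodal_field := fun k => entropy_vars fl (v_bnd k).

Definition Pi_int (j : 'I_3) : nodal_field := fun k =>
  dVdW fl (v k) *m Theta j k.

Definition Pi_bnd (j : 'I_3) : nodal_field := fun k =>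
  vec5 (- rho (Pi_int j k)) (vel (Pi_int j k)) (- temp (Pi_int j k)).

Definition Theta_bnd (j : 'I_3) : nodal_field := fun k =>
  dWdV fl (v_bnd k) *m Pi_bnd j k.

Definition f_int : nodal_field := disc_flux v Theta ord0.
Definition f_bnd : nodal_field := disc_flux v_bnd Theta_bnd ord0.

Definition pen_q : nodal_field := fun k => 2^-1 *: (f_int k - f_bnd k).
Definition pen_Theta : nodal_field := fun k => 2^-1 *: (w_int k - w_bnd k).
Definition pen_heat : nodal_field := fun k =>
  - (temp (v k) * g) *: delta_mx (inord 4) 0.

Definition Xi_V : R :=
  \sum_(k : node | on_wall k)
    face_weight ord0 k *
    (- dot5 (w_int k) (f_int k)
     + dot5 (w_int k) (pen_q k + pen_heat k)
     + dot5 (f_int k) (pen_Theta k)).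

End Wall.

(* The parts of the scheme that do not enter the viscous wall treatment, as
   functions of time, of the nodal state and of the discrete gradients: the
   inviscid discretization with its wall penalty, and the penalties of the
   other faces and of the interfaces in both equations. *)
Record remainder := Remainder {
  rem_inviscid : R -> nodal_field -> nodal_field;
  rem_other_q : R -> nodal_field -> ('I_3 -> nodal_field) -> nodal_field;
  rem_other_Theta :
    R -> nodal_field -> ('I_3 -> nodal_field) -> 'I_3 -> nodal_field
}.

Definition gradient_equation (rem : remainder)
    (uw : node -> 'I_3 -> R) (t : R)
    (v : nodal_field) (Theta : 'I_3 -> nodal_field)
    : Prop :=
  forall (m : 'I_3) (k : node),
    Theta m k - D_apply m (w_int v) k
    = (if m == ord0 then wall_lift (pen_Theta uw v) k else 0)
      + rem_other_Theta rem t v Theta m k.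

Definition dq_dt (rem : remainder) (uw : node -> 'I_3 -> R) (g t : R)
    (v : nodal_field) (Theta : 'I_3 -> nodal_field) : nodal_field := fun k =>
  rem_inviscid rem t v k
  + \sum_(m < 3) D_apply m (disc_flux v Theta m) k
  + wall_lift (fun a => pen_q uw v Theta a + pen_heat g v a) k
  + rem_other_q rem t v Theta k.

(* Numerical solution on the time interval [0, tf]. *)
Definition numerical_solution (rem : remainder) (tf : R)
    (uw : R -> node -> 'I_3 -> R) (g : R -> R)
    (v : R -> nodal_field) (Theta : R -> 'I_3 -> nodal_field) : Prop :=
  [/\ forall t k, t \in `[0, tf] -> admissible (v t k),
      forall t, t \in `[0, tf] ->
        gradient_equation rem (uw t) t (v t) (Theta t) &
      forall t k i, t \in `]0, tf[ ->
        is_derive t 1 (fun s : R => conserved fl (v s k) i 0 : R)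
          (dq_dt rem (uw t) (g t) t (v t) (Theta t) k i 0)].

(* The discrete entropy balance that the scheme implies, see entropy_balance
   below.  dissipation is DT, Xi_inviscid is the contracted inviscid part, and
   Xi_other gathers the faces and interfaces other than the wall. *)
Section Balance.
Context (rem : remainder) (t : R)
        (v : nodal_field) (Theta : 'I_3 -> nodal_field).

Definition total_entropy : R :=
  \sum_(k : node) vol_weight k * entropy_function fl (v k).

Definition dissipation : R :=
  \sum_(k : node) vol_weight k *
    \sum_(m < 3) dot5 (disc_flux v Theta m k) (Theta m k).

Definition Xi_inviscid : R :=
  \sum_(k : node) vol_weight k * dot5 (w_int v k) (rem_inviscid rem t v k).

Definition Xi_other : R :=
  \sum_(k : node) vol_weight k *
    (dot5 (w_int v k) (rem_other_q rem t v Theta k)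
     + \sum_(m < 3) dot5 (disc_flux v Theta m k)
                         (rem_other_Theta rem t v Theta m k))
  + \sum_(m < 3) \sum_(k : node | k m == ord_max)
      face_weight m k * dot5 (w_int v k) (disc_flux v Theta m k)
  - \sum_(m < 3 | m != ord0) \sum_(k : node | k m == ord0)
      face_weight m k * dot5 (w_int v k) (disc_flux v Theta m k).

End Balance.

End Discretization.

Arguments nodal_field : clear implicits.
Arguments node : clear implicits.
Arguments remainder : clear implicits.

Definition square_integrable (R : realType) (tf : R) (g : R -> R) : Prop :=
  (fun t : R => g t * \1_(`[0, tf] : set R) t) \in Lfun lebesgue_measure 2%:E.

Section Facts.
Context {R : realType}.
Lemma rhoE (a : R) b c : rho (vec5 a b c) = a.
Proof. by rewrite /rho /vec5 mxE inordK. Qed.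
Lemma tempE (a : R) b c : temp (vec5 a b c) = c.
Proof. by rewrite /temp /vec5 mxE inordK. Qed.
Lemma velE (a : R) b c i : vel (vec5 a b c) i = b i.
Proof.
rewrite /vel /vec5 mxE inordK; last by rewrite ltnS (leq_trans (ltn_ord i)).
by case: i => [[|[|[|//]]] h] /=; congr b; apply: val_inj; rewrite /= inordK.
Qed.
Lemma dotE (a b : 'cV[R]_5) : dot5 a b =
  rho a * rho b + \sum_(i < 3) vel a i * vel b i + temp a * temp b.
Proof.
have e (i j : 'I_5) : nat_of_ord i = nat_of_ord j ->
    a i 0 * b i 0 = a j 0 * b j 0 by move=> /val_inj ->.
rewrite /dot5 !big_ord_recl !big_ord0 /rho /vel /temp !addr0 /= -!addrA.
by do 4 (congr (_ + _); first by apply: e; rewrite ?inordK); apply: e; rewrite ?inordK.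
Qed.
Lemma dot5Dr (a b c : 'cV[R]_5) : dot5 a (b + c) = dot5 a b + dot5 a c.
Proof. by rewrite /dot5 -big_split; apply: eq_bigr => i _; rewrite mxE mulrDr. Qed.
Lemma dot5Zr (a b : 'cV[R]_5) c : dot5 a (c *: b) = c * dot5 a b.
Proof. by rewrite /dot5 mulr_sumr; apply: eq_bigr => i _; rewrite mxE mulrCA. Qed.
Lemma dot5C (a b : 'cV[R]_5) : dot5 a b = dot5 b a.
Proof. by apply: eq_bigr => i _; rewrite mulrC. Qed.
Lemma dot50 (a : 'cV[R]_5) : dot5 a 0 = 0.
Proof. by rewrite -(scale0r 0) dot5Zr mul0r. Qed.
Lemma dot5_sumr (a : 'cV[R]_5) I r (P : pred I) (F : I -> 'cV[R]_5) :
  dot5 a (\sum_(i <- r | P i) F i) = \sum_(i <- r | P i) dot5 a (F i).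
Proof. exact: (big_morph _ (dot5Dr a) (dot50 a)). Qed.


Lemma sum3 (F : 'I_3 -> R) : \sum_(i < 3) F i = F 0 + F 1 + F (1 + 1).
Proof.
rewrite !big_ord_recl big_ord0 addr0 addrA.
by congr (_ + F _ + F _); apply: val_inj.
Qed.

Section DerivativeRules.
Context (t : R).
Local Notation der f d := (is_derive (t : R) (1 : R) (f : R -> R) (d : R)).
Local Lemma dM f g df dg : der f df -> der g dg -> der (fun s => f s * g s) (df * g t + f t * dg).
Proof.
move=> hf hg; apply: (@is_derive_eq R R R (f * g) t 1 _ _ (is_deriveM hf hg)).
by rewrite addrC; congr (_ + _); exact: mulrC.
Qed.
Local Lemma dD f g df dg : der f df -> der g dg -> der (fun s => f s + g s) (df + dg).
Proof. move=> hf hg; exact: (is_deriveD hf hg). Qed.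
Local Lemma dN f df : der f df -> der (fun s => - f s) (- df).
Proof. move=> hf; exact: (is_deriveN hf). Qed.
Local Lemma dC (c : R) : der (fun=> c) 0.
Proof. exact: is_derive_cst. Qed.
Local Lemma dV f df : f t != 0 -> der f df -> der (fun s => (f s)^-1) (- (f t) ^- 2 * df).
Proof. move=> h hf; exact: (is_deriveV h hf). Qed.
Local Lemma dL f df : 0 < f t -> der f df -> der (fun s => ln (f s)) ((f t)^-1 * df).
Proof. by move=> h hf; exact: (@is_derive1_comp _ (@ln R) f t _ _ (is_derive1_ln h) hf). Qed.
Local Lemma dEq f d d' : der f d -> d = d' -> der f d'.
Proof. by move=> h <-. Qed.
End DerivativeRules.
Lemma is_derive_entropy (fl : fluid R) (v : R -> 'cV[R]_5) (t : R) (dq : 'cV[R]_5) :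
  (\near t, admissible (v t)) ->
  (forall i, is_derive t 1 (fun s : R => conserved fl (v s) i 0 : R) (dq i 0)) ->
  is_derive t 1 (fun s : R => entropy_function fl (v s)) (dot5 (entropy_vars fl (v t)) dq).
Proof.
move=> av hq.
have at0 : admissible (v t) by exact: nbhs_singleton av.
have R0 := Rg_gt0 fl; have cR := cP_gtRg fl.
pose cv := cP fl - Rg fl.
have cv0 : cv != 0 by rewrite /cv subr_eq0; apply/eqP; lra.
have gE : Rg fl / (gamma fl - 1) = cv.
  rewrite /gamma /cv. field.
  by rewrite cv0 /=; apply/eqP; lra.
pose a s : R := rho (conserved fl (v s)).
pose b i s : R := vel (conserved fl (v s)) i.
pose c s : R := temp (conserved fl (v s)).
have aE s : a s = rho (v s) by rewrite /a rhoE.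
have bE i s : b i s = rho (v s) * vel (v s) i by rewrite /b velE.
have cE s : c s = rho (v s) * (cv * temp (v s) + (\sum_(i < 3) vel (v s) i ^+ 2) / 2).
  by rewrite /c tempE gE.
have da : is_derive t 1 (a : R -> R) (rho dq) by exact: hq.
have db i : is_derive t 1 (b i : R -> R) (vel dq i) by exact: hq.
have dc : is_derive t 1 (c : R -> R) (temp dq) by exact: hq.
pose T s := (c s * (a s)^-1 - 2^-1 * (a s)^-1 * (a s)^-1 * (b 0 s * b 0 s + b 1 s * b 1 s + b (1+1) s * b (1+1) s)) * cv^-1.
have sumE (u : 'cV[R]_5) : \sum_(i < 3) vel u i ^+ 2 = vel u 0 * vel u 0 + vel u 1 * vel u 1 + vel u (1+1) * vel u (1+1).
  by rewrite sum3 !expr2.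
have TE s : admissible (v s) -> T s = temp (v s).
  move=> [r0 _]; rewrite /T !bE aE cE sumE; field.
  by rewrite cv0 gt_eqF.
pose S (s : R) : R := - (a s * (cv * ln (T s * (T_inf fl)^-1) - Rg fl * ln (a s * (rho_inf fl)^-1))).
have [r0 T0] := at0.
have Tt : T t = temp (v t) by exact: TE.
apply: (@near_eq_is_derive _ _ _ S).
  near=> s.
  have /TE h : admissible (v s) by near: s.
  by rewrite /S /entropy_function /thermo_entropy gE h aE.
have a0 : a t != 0 by rewrite aE gt_eqF.
have ri0 := rho_inf_gt0 fl; have Ti0 := T_inf_gt0 fl.
have dai := dV a0 da.
have dbb i := dM (db i) (db i).
have dT : is_derive t 1 (T : R -> R) _ :=
  dM (dD (dM dc dai) (dN (dM (dM (dM (dC t 2^-1) dai) dai)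
    (dD (dD (dbb 0) (dbb 1)) (dbb (1+1)))))) (dC t cv^-1).
have hT : 0 < T t * (T_inf fl)^-1 by rewrite Tt divr_gt0.
have hr : 0 < a t * (rho_inf fl)^-1 by rewrite aE divr_gt0.
have dSS := dN (dM da (dD (dM (dC t cv) (dL (f := fun s => T s * (T_inf fl)^-1) hT (dM dT (dC t (T_inf fl)^-1))))
  (dN (dM (dC t (Rg fl)) (dL (f := fun s => a s * (rho_inf fl)^-1) hr (dM da (dC t (rho_inf fl)^-1))))))).
apply: (dEq dSS).
rewrite dotE /entropy_vars rhoE tempE /thermo_entropy gE !Tt.
have -> : \sum_(i < 3) vel (vec5 (cP fl - (cv * ln (temp (v t) / T_inf fl) - Rg fl * ln (rho (v t) / rho_inf fl)) - (\sum_(i0 < 3) vel (v t) i0 ^+ 2) / (2 * temp (v t))) (fun i : 'I_3 => vel (v t) i / temp (v t)) (- (temp (v t))^-1)) i * vel dq i = vel (v t) 0 / temp (v t) * vel dq 0 + vel (v t) 1 / temp (v t) * vel dq 1 + vel (v t) (1+1) / temp (v t) * vel dq (1+1).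
  under eq_bigr do rewrite velE.
  exact: sum3.
rewrite sumE !bE !aE !cE !sumE.
have -> : cP fl = cv + Rg fl by rewrite /cv subrK.
field.
by rewrite cv0 !gt_eqF.
Unshelve. all: by end_near. Qed.

Section EntropyBalance.
Context {N : nat} (E : element R N) (fl : fluid R)
  (C : 'I_3 -> 'I_3 -> 'cV[R]_5 -> 'M[R]_5).
Implicit Types (k : node N) (m : 'I_3).

Lemma vol_face m k : vol_weight E k = P1d E m 0 (k m) * face_weight E m k.
Proof. exact: (bigD1 m). Qed.

Lemma face_set m k l : face_weight E m (set_coord k m l) = face_weight E m k.
Proof. by apply: eq_bigr => n /negbTE nm; rewrite ffunE nm. Qed.

Lemma swapK m : involutive (fun x : node N * 'I_N.+1 => (set_coord x.1 m x.2, x.1 m)).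
Proof.
move=> [k l] /=; rewrite ffunE eqxx; congr pair.
by apply/ffunP => n; rewrite !ffunE; case: eqP => // ->.
Qed.

Lemma sbp1 m i j : P1d E m 0 i * D1d E m i j + P1d E m 0 j * D1d E m j i =
  ((i == ord_max) && (j == ord_max))%:R - ((i == ord0) && (j == ord0))%:R.
Proof.
have [_ _ /matrixP /(_ i j)] := D1d_sbp E m.
rewrite mul_diag_mx !mxE => <-; by [].
Qed.

Lemma set_id k m : set_coord k m (k m) = k.
Proof. by apply/ffunP => n; rewrite ffunE; case: eqP => // ->. Qed.

Lemma sbp_sum m (w f : nodal_field R N) :
  \sum_(k : node N) vol_weight E k * dot5 (w k) (D_apply E m f k)
  + \sum_(k : node N) vol_weight E k * dot5 (f k) (D_apply E m w k) =
  \sum_(k : node N | k m == ord_max) face_weight E m k * dot5 (w k) (f k)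
  - \sum_(k : node N | k m == ord0) face_weight E m k * dot5 (w k) (f k).
Proof.
have ex (u z : nodal_field R N) : \sum_(k : node N) vol_weight E k * dot5 (u k) (D_apply E m z k) =
   \sum_(k : node N) \sum_(l < N.+1) face_weight E m k * (P1d E m 0 (k m) * D1d E m (k m) l * dot5 (u k) (z (set_coord k m l))).
  apply: eq_bigr => k _; rewrite /D_apply dot5_sumr mulr_sumr; apply: eq_bigr => l _.
  by rewrite dot5Zr (vol_face m); ring.
rewrite !ex.
rewrite [X in _ + X](_ : _ = \sum_(k : node N) \sum_(l < N.+1) face_weight E m k * (P1d E m 0 l * D1d E m l (k m) * dot5 (w k) (f (set_coord k m l)))); last first.
  rewrite !pair_big /= (reindex_inj (inv_inj (swapK m))) /=.
  apply: eq_bigr => -[k l] _ /=; rewrite face_set ffunE eqxx.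
  have := swapK m (k, l); rewrite /= => -[-> _].
  by rewrite dot5C.
rewrite -big_split /= [X in _ = X - _]big_mkcond [X in _ = _ - X]big_mkcond -sumrB.
apply: eq_bigr => k _; rewrite -big_split /=.
under eq_bigr do rewrite -mulrDr -mulrDl sbp1.
rewrite (bigD1 (k m)) //= big1 ?addr0; last first.
  move=> l /negbTE lk.
  have e M : (k m == M) && (l == M) = false.
    by apply: contraFF lk => /andP[/eqP -> /eqP ->].
  by rewrite !e subrr mul0r mulr0.
rewrite set_id !andbb -!mulrb; case: (k m == ord_max); case: (k m == ord0) => /=; ring.
Qed.

Lemma lift_sum (w g : nodal_field R N) :
  \sum_(k : node N) vol_weight E k * dot5 (w k) (wall_lift E g k) =
  \sum_(k : node N | on_wall k) face_weight E ord0 k * dot5 (w k) (g k).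
Proof.
rewrite [RHS]big_mkcond; apply: eq_bigr => k _; rewrite /wall_lift.
case: ifP => _; last by rewrite dot50 mulr0.
rewrite dot5Zr (vol_face ord0).
have [/(_ (k ord0)) P0 _ _] := D1d_sbp E ord0.
by field; rewrite gt_eqF.
Qed.

Context (rem : remainder R N) (tf : R) (uw : R -> node N -> 'I_3 -> R) (g : R -> R)
   (v : R -> nodal_field R N) (Theta : R -> 'I_3 -> nodal_field R N).

Lemma entropy_balance : numerical_solution E fl C rem tf uw g v Theta ->
  forall t, t \in `]0, tf[ ->
  is_derive t 1 (fun s : R => total_entropy E fl (v s))
   (- dissipation E C (v t) (Theta t)
    + Xi_inviscid E fl rem t (v t)
    + Xi_V E fl C (uw t) (g t) (v t) (Theta t)
    + Xi_other E fl C rem t (v t) (Theta t)).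
Proof.
move=> [adm grad evo] t t0.
have t1 : t \in `[0, tf] by exact: subset_itv_oo_cc.
have dk k : is_derive t 1 (fun s : R => entropy_function fl (v s k))
    (dot5 (w_int fl (v t) k) (dq_dt E fl C rem (uw t) (g t) t (v t) (Theta t) k)).
  apply: is_derive_entropy; last by move=> i; exact: evo.
  near=> s; apply: adm; apply: subset_itv_oo_cc; near: s.
  exact: near_in_itvoo.
have dsum : is_derive t 1 (fun s : R => total_entropy E fl (v s))
   (\sum_(k : node N) vol_weight E k * dot5 (w_int fl (v t) k) (dq_dt E fl C rem (uw t) (g t) t (v t) (Theta t) k)).
  rewrite /total_entropy unlock /=.
  elim: (index_enum _) => [|k r IH] /=; first exact: dC.
  have hk : is_derive t 1 (fun s : R => vol_weight E k * entropy_function fl (v s k)) (vol_weight E k * dot5 (w_int fl (v t) k) (dq_dt E fl C rem (uw t) (g t) t (v t) (Theta t) k)).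
    by apply: (dEq (dM (dC t _) (dk k))); ring.
  exact: (dD hk IH).
apply: (dEq dsum); clear dsum dk.
set w := w_int fl (v t); set F := disc_flux C (v t) (Theta t).
have flux m : \sum_(k : node N) vol_weight E k * dot5 (w k) (D_apply E m (F m) k) =
  \sum_(k : node N | k m == ord_max) face_weight E m k * dot5 (w k) (F m k)
  - \sum_(k : node N | k m == ord0) face_weight E m k * dot5 (w k) (F m k)
  - \sum_(k : node N) vol_weight E k * dot5 (F m k) (Theta t m k)
  + \sum_(k : node N) vol_weight E k * dot5 (F m k) (rem_other_Theta rem t (v t) (Theta t) m k)
  + (if m == ord0 then \sum_(k : node N | on_wall k) face_weight E ord0 k * dot5 (F m k) (pen_Theta fl (uw t) (v t) k) else 0).
  rewrite -sbp_sum -!addrA; apply/esym; rewrite -[RHS]addr0; congr (_ + _).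
  have -> : (if m == ord0 then \sum_(k : node N | on_wall k) face_weight E ord0 k * dot5 (F m k) (pen_Theta fl (uw t) (v t) k) else 0) =
    \sum_(k : node N) vol_weight E k * dot5 (F m k) (if m == ord0 then wall_lift E (pen_Theta fl (uw t) (v t)) k else 0).
    case: ifP => _; first by rewrite lift_sum.
    by rewrite big1 // => k _; rewrite dot50 mulr0.
  rewrite -sumrN -!big_split /= big1 // => k _.
  have /(congr1 (dot5 (F m k))) := grad t t1 m k.
  rewrite -(scaleN1r (D_apply _ _ _ _)) !dot5Dr dot5Zr => h.
  rewrite -!mulrN -!mulrDr.
  rewrite [X in _ * X](_ : _ = 0) ?mulr0 //.
  by move: h; rewrite -/w; lra.
have -> : \sum_(k : node N) vol_weight E k * dot5 (w k) (dq_dt E fl C rem (uw t) (g t) t (v t) (Theta t) k) =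
  \sum_(k : node N) vol_weight E k * dot5 (w k) (rem_inviscid rem t (v t) k)
  + \sum_(m < 3) \sum_(k : node N) vol_weight E k * dot5 (w k) (D_apply E m (F m) k)
  + \sum_(k : node N | on_wall k) face_weight E ord0 k * dot5 (w k) (pen_q fl C (uw t) (v t) (Theta t) k + pen_heat (g t) (v t) k)
  + \sum_(k : node N) vol_weight E k * dot5 (w k) (rem_other_q rem t (v t) (Theta t) k).
  rewrite -lift_sum exchange_big -!big_split /=; apply: eq_bigr => k _.
  by rewrite /dq_dt !dot5Dr dot5_sumr -mulr_sumr !mulrDr.
rewrite (eq_bigr _ (fun m _ => flux m)) !big_split /= !sumrN.
rewrite -big_mkcond big_pred1_eq.
have -> : dissipation E C (v t) (Theta t) =
  \sum_(m < 3) \sum_(k : node N) vol_weight E k * dot5 (F m k) (Theta t m k).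
  by rewrite exchange_big; apply: eq_bigr => k _; rewrite mulr_sumr.
have -> : Xi_V E fl C (uw t) (g t) (v t) (Theta t) =
  - \sum_(k : node N | k ord0 == ord0) face_weight E ord0 k * dot5 (w k) (F ord0 k)
  + \sum_(k : node N | on_wall k) face_weight E ord0 k * dot5 (w k) (pen_q fl C (uw t) (v t) (Theta t) k + pen_heat (g t) (v t) k)
  + \sum_(k : node N | on_wall k) face_weight E ord0 k * dot5 (F ord0 k) (pen_Theta fl (uw t) (v t) k).
  by rewrite -sumrN -!big_split /=; apply: eq_bigr => k _; rewrite !mulrDr mulrN.
rewrite /Xi_other -/w -/F.
have -> : \sum_(k : node N) vol_weight E k *
    (dot5 (w k) (rem_other_q rem t (v t) (Theta t) k)
     + \sum_(m < 3) dot5 (F m k) (rem_other_Theta rem t (v t) (Theta t) m k)) =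
   \sum_(k : node N) vol_weight E k * dot5 (w k) (rem_other_q rem t (v t) (Theta t) k)
   + \sum_(m < 3) \sum_(k : node N) vol_weight E k * dot5 (F m k) (rem_other_Theta rem t (v t) (Theta t) m k).
  rewrite exchange_big -big_split /=; apply: eq_bigr => k _.
  by rewrite mulrDr; congr (_ + _); exact: mulr_sumr.
have -> : \sum_(m < 3) \sum_(k : node N | k m == ord0) face_weight E m k * dot5 (w k) (F m k) =
  \sum_(k : node N | k ord0 == ord0) face_weight E ord0 k * dot5 (w k) (F ord0 k) +
  \sum_(m < 3 | m != ord0) \sum_(k : node N | k m == ord0) face_weight E m k * dot5 (w k) (F m k).
  by rewrite (bigD1 ord0).
rewrite /Xi_inviscid -/w.
lra.
Unshelve. all: by end_near. Qed.
End EntropyBalance.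
End Facts.

(* Main.v *)
Require Import Defs.
From HB Require Import structures.
From mathcomp Require Import all_boot all_order all_algebra.
From mathcomp Require Import all_classical all_reals all_analysis.
From mathcomp Require Import ring lra.

(** At a wall node the penalties reduce the viscous terms to
    [- (w . f_B + w_B . f) / 2 + w . L], where [w, f] belong to the interior
    state and [w_B, f_B] to the boundary state; the two mixed products are all
    that is left of [- w . f] after the two one-half penalties.

    Every mixed product is given by one formula ([dot_entropy_vars_flux]): the
    entropy variables of [v] against the viscous flux at [v'] give
    [(sum_i tau_i (U_i(v) - U_i(v')) - kappa T_x) / T(v)].  The boundary state
    has the temperature of the interior state, hence the same [mu] and [kappa];
    the boundary gradients have the same velocity part, hence the same stress,
    and the opposite temperature part.  Exchanging interior and boundary
    therefore reverses the sign of both terms of the formula, and the two mixed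
    products cancel.  What remains is [w . L], in which the component
    [- 1 / T] of [w] removes the factor [T] from the heat penalty and leaves the
    datum [g].  Summed over the wall, the contribution is [g] times the area of
    the face as measured by the quadrature.

    One point needs an argument.  The boundary flux is defined through the
    gradients of the boundary entropy variables, so reading it as a flux of the
    boundary primitive gradients requires the Jacobian of the entropy variables
    to be invertible.  In the order (density, velocity, temperature) it is upper
    triangular, with diagonal [R / rho, 1 / T, 1 / T, 1 / T, 1 / T ^ 2]
    ([dWdV_unitmx]). *)

Import Order.TTheory GRing.Theory Num.Theory.
Import numFieldNormedType.Exports.

Local Open Scope classical_set_scope.
Local Open Scope ring_scope.

Section WallPenalty.
Context {R : realType}.
Implicit Types (v : 'cV[R]_5) (G H : 'I_3 -> 'cV[R]_5).

(** * Invertibility of the Jacobian of the entropy variables *)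

(** Restricting to a coordinate line turns the entries of a Jacobian into
    derivatives of functions of one real variable. *)
Lemma jacobian5_line (f : 'cV[R]_5 -> 'cV[R]_5) v (i j : 'I_5) :
  jacobian5 f v i j =
  'D_1 (fun h : R => f (h *: delta_mx j 0 + v) i 0 : R) 0.
Proof.
have eq_lim (F G : R -> R) : F =1 G -> lim (F @ 0^') = lim (G @ 0^').
  by move=> /funext ->.
rewrite mxE /derive; apply: eq_lim => h /=.
by rewrite addr0 scale0r add0r [h *: 1]mulr1.
Qed.

Lemma line_coord (h : R) (j : 'I_5) v (n : nat) : (n < 5)%N ->
  (h *: delta_mx j 0 + v) (inord n) 0 = h * (n == j)%:R + v (inord n) 0.
Proof. by move=> n5; rewrite !mxE eqxx andbT -val_eqE /= inordK. Qed.

Lemma rho_line (h : R) (j : 'I_5) v :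
  rho (h *: delta_mx j 0 + v) = h * (0%N == j)%:R + rho v.
Proof. exact: line_coord. Qed.

Lemma vel_line (h : R) (j : 'I_5) v (i : 'I_3) :
  vel (h *: delta_mx j 0 + v) i = h * (i.+1 == j)%:R + vel v i.
Proof. by apply: line_coord; rewrite ltnS (leq_trans (ltn_ord i)). Qed.

Lemma temp_line (h : R) (j : 'I_5) v :
  temp (h *: delta_mx j 0 + v) = h * (4%N == j)%:R + temp v.
Proof. exact: line_coord. Qed.

Lemma ord5_cases (i : 'I_5) :
  [\/ i = inord 0, exists l : 'I_3, i = inord l.+1 | i = inord 4].
Proof.
have e n : nat_of_ord i = n -> (n < 5)%N -> i = inord n.
  by move=> i_n n5; apply: val_inj; rewrite /= inordK.
case: (ltnP i 4) => [i4|i4]; last first.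
  by constructor 3; apply: e => //; apply/eqP; rewrite eqn_leq i4 -ltnS ltn_ord.
case: (posnP i) => [i0|i0]; first by constructor 1; apply: e.
constructor 2; have i3 : (i.-1 < 3)%N by rewrite -ltnS prednK.
by exists (Ordinal i3); apply: e; rewrite /= prednK.
Qed.

Context (fl : fluid R).

Lemma rho_entropy_vars v :
  rho (entropy_vars fl v) =
  cP fl - thermo_entropy fl v - (\sum_(i < 3) vel v i ^+ 2) / (2 * temp v).
Proof. exact: rhoE. Qed.

Lemma vel_entropy_vars v i : vel (entropy_vars fl v) i = vel v i / temp v.
Proof. exact: velE. Qed.

Lemma temp_entropy_vars v : temp (entropy_vars fl v) = - (temp v)^-1.
Proof. exact: tempE. Qed.

(** The velocity components of the entropy variables involve one velocity and
    the temperature, and the last component only the temperature, so these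
    components are constant along the coordinate lines of lower index. *)
Lemma dWdV_lower v (i j : 'I_5) : (j < i)%N -> dWdV fl v i j = 0.
Proof.
move=> ji; rewrite /dWdV jacobian5_line.
rewrite [X in derive X _ _](_ : _ = cst (entropy_vars fl v i 0)) ?derive_cst//.
apply/funext => h /=; case: (ord5_cases i) ji => [->|[l ->]|->].
- by rewrite inordK.
- have l5 : (l.+1 < 5)%N by rewrite ltnS (leq_trans (ltn_ord l)).
  rewrite inordK // => jl.
  rewrite -!/(vel _ l) !vel_entropy_vars vel_line temp_line.
  rewrite (gtn_eqF jl) gtn_eqF ?mulr0 ?add0r//.
  by rewrite (leq_trans jl) // ltn_ord.
- rewrite inordK // => j4.
  by rewrite -!/(temp _) !temp_entropy_vars temp_line gtn_eqF // mulr0 add0r.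
Qed.

Lemma dWdV_rho v : 0 < rho v ->
  dWdV fl v (inord 0) (inord 0) = Rg fl / rho v.
Proof.
move=> r0; rewrite /dWdV jacobian5_line.
have ri0 := rho_inf_gt0 fl.
(* Everything in the first entropy variable that a change of density leaves
   fixed. *)
pose c : R := cP fl - Rg fl / (gamma fl - 1) * ln (temp v / T_inf fl)
  - (\sum_(i < 3) vel v i ^+ 2) / (2 * temp v).
rewrite [X in derive X _ _](_ : _ =
    (fun h => c + Rg fl * ln ((h + rho v) * (rho_inf fl)^-1))); last first.
  apply/funext => h; rewrite -/(rho _) rho_entropy_vars /thermo_entropy.
  rewrite temp_line rho_line !inordK // mulr0 add0r mulr1.
  under eq_bigr do rewrite vel_line inordK // mulr0 add0r.
  by rewrite /c; ring.
pose a (h : R) : R := (h + rho v) * (rho_inf fl)^-1.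
have da : is_derive (0 : R) (1 : R) a (rho_inf fl)^-1.
  apply: (Defs.dEq (Defs.dM (Defs.dD (@is_derive_id R R 0 1)
    (Defs.dC 0 (rho v))) (Defs.dC 0 (rho_inf fl)^-1))).
  by rewrite mulr0 !addr0 mul1r.
have a_gt0 : 0 < a 0 by rewrite /a add0r divr_gt0.
have := Defs.dD (Defs.dC 0 c) (Defs.dM (Defs.dC 0 (Rg fl)) (Defs.dL a_gt0 da)).
move=> /(@derive_val _ _ _ _ _ _ _) ->.
by rewrite /a !add0r mul0r add0r; field; rewrite !gt_eqF.
Qed.

Lemma dWdV_vel v (l : 'I_3) :
  dWdV fl v (inord l.+1) (inord l.+1) = (temp v)^-1.
Proof.
have l5 : (l.+1 < 5)%N by rewrite ltnS (leq_trans (ltn_ord l)).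
rewrite /dWdV jacobian5_line.
rewrite [X in derive X _ _](_ : _ =
    (fun h => (h + vel v l) * (temp v)^-1)); last first.
  apply/funext => h; rewrite -/(vel _ l) vel_entropy_vars vel_line temp_line.
  by rewrite inordK // eqxx gtn_eqF ?mulr1 ?mulr0 ?add0r // ltnS ltn_ord.
have := Defs.dM (Defs.dD (@is_derive_id R R 0 1) (Defs.dC 0 (vel v l)))
  (Defs.dC 0 (temp v)^-1).
by move=> /(@derive_val _ _ _ _ _ _ _) ->; rewrite mulr0 !addr0 mul1r.
Qed.

Lemma dWdV_temp v : 0 < temp v ->
  dWdV fl v (inord 4) (inord 4) = temp v ^- 2.
Proof.
move=> T0; rewrite /dWdV jacobian5_line.
rewrite [X in derive X _ _](_ : _ = (fun h => - (h + temp v)^-1)); last first.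
  apply/funext => h; rewrite -/(temp _) temp_entropy_vars temp_line.
  by rewrite inordK // mulr1.
pose a (h : R) : R := h + temp v.
have a_neq0 : a 0 != 0 by rewrite /a add0r gt_eqF.
have da : is_derive (0 : R) (1 : R) a (1 + 0).
  exact: (Defs.dD (@is_derive_id R R 0 1) (Defs.dC 0 (temp v))).
have := Defs.dN (Defs.dV a_neq0 da).
by move=> /(@derive_val _ _ _ _ _ _ _) ->; rewrite /a add0r addr0 mulr1 opprK.
Qed.

Lemma dWdV_unitmx v : admissible v -> dWdV fl v \in unitmx.
Proof.
move=> [r0 T0]; rewrite unitmxE unitfE -det_tr det_trig; last first.
  by apply/is_trig_mxP => i j ij; rewrite mxE dWdV_lower.
apply/prodf_neq0 => i _; rewrite mxE; case: (ord5_cases i) => [->|[l ->]|->].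
- by rewrite dWdV_rho // gt_eqF // divr_gt0 // Rg_gt0.
- by rewrite dWdV_vel invr_eq0 gt_eqF.
- by rewrite dWdV_temp // invr_eq0 expf_neq0 // gt_eqF.
Qed.

(** * Entropy variables against viscous fluxes *)

(** The stress sees a state only through its temperature, and a gradient only
    through its velocity part: the boundary data keep both. *)
Lemma eq_stress v v' G H i j :
  temp v = temp v' -> (forall m, vel (G m) = vel (H m)) ->
  stress fl v G i j = stress fl v' H i j.
Proof.
move=> eT eG; rewrite /stress eT !eG; congr (_ * (_ - _ * _)).
by apply: eq_bigr => n _; rewrite eG.
Qed.

(** The states of the entropy variables and of the flux are kept apart, since
    the penalties pair the interior with the boundary.  The work of the stress
    enters through the momentum with velocity [vel v] and through the energy
    with velocity [vel v'], so only the velocity jump survives. *)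
Lemma dot_entropy_vars_flux v v' G m :
  dot5 (entropy_vars fl v) (viscous_flux fl v' G m) =
  (\sum_(i < 3) stress fl v' G i m * (vel v i - vel v' i)
   - kappa fl (temp v') * temp (G m)) / temp v.
Proof.
rewrite dotE temp_entropy_vars /viscous_flux rhoE tempE mulr0 add0r.
under eq_bigr do rewrite velE vel_entropy_vars.
under [in RHS]eq_bigr do rewrite mulrBr.
rewrite sumrB [in RHS]mulrBl mulrBl mulr_suml mulNr.
rewrite [X in X - _](eq_bigr (fun i => stress fl v' G i m * vel v i / temp v)).
  by ring.
by move=> i _; ring.
Qed.

(** This is the mechanism of both parts of the theorem: the pairing above is
    odd under the exchange of two states of equal temperature whose gradients
    have equal velocity and opposite temperature parts. *)
Lemma mixed_products_cancel v v' G H m :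
  temp v' = temp v -> (forall j, vel (H j) = vel (G j)) ->
  temp (H m) = - temp (G m) ->
  dot5 (entropy_vars fl v) (viscous_flux fl v' H m)
  + dot5 (entropy_vars fl v') (viscous_flux fl v G m) = 0.
Proof.
move=> eT eV eTm; rewrite !dot_entropy_vars_flux eT eTm -mulrDl.
under eq_bigr do rewrite (eq_stress _ v _ G) //.
rewrite addrACA -big_split /= big1 => [|i _]; last by ring.
by rewrite add0r mulrN opprK subrr mul0r.
Qed.

(** * The viscous wall contribution *)

Context (C : 'I_3 -> 'I_3 -> 'cV[R]_5 -> 'M[R]_5)
        (hC : viscous_coefficients fl C).
Context {N : nat} (E : element R N).
Context (uw : node N -> 'I_3 -> R) (g : R)
        (v : nodal_field R N) (Theta : 'I_3 -> nodal_field R N).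
Implicit Types k : node N.

Lemma f_intE k : admissible (v k) ->
  f_int C v Theta k =
  viscous_flux fl (v k) (fun j => Pi_int fl v Theta j k) ord0.
Proof. by move=> vk; rewrite /f_int /disc_flux -hC. Qed.

Lemma admissible_v_bnd k : admissible (v k) -> admissible (v_bnd uw v k).
Proof. by rewrite /admissible rhoE tempE. Qed.

(** The Jacobian and its inverse cancel at the boundary state, so the boundary
    flux is the physical flux of the prescribed primitive gradients. *)
Lemma f_bndE k : admissible (v k) ->
  f_bnd fl C uw v Theta k =
  viscous_flux fl (v_bnd uw v k) (fun j => Pi_bnd fl v Theta j k) ord0.
Proof.
move=> vk; have vBk := admissible_v_bnd _ vk.
rewrite /f_bnd /disc_flux -hC //; congr viscous_flux; apply/funext => j.
by rewrite /Theta_bnd /dVdW mulKmx // dWdV_unitmx.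
Qed.

(** The factor [T] in the heat penalty is there to be absorbed by the last
    entropy variable [- 1 / T]: the product no longer sees the solution. *)
Lemma dot_w_heat k : admissible (v k) ->
  dot5 (w_int fl v k) (pen_heat g v k) = g.
Proof.
move=> [_ T0]; rewrite /pen_heat dot5Zr /dot5 (bigD1 (inord 4)) //= big1.
  rewrite -/(temp _) temp_entropy_vars mxE !eqxx addr0 mulr1.
  by field; rewrite gt_eqF.
by move=> i /negbTE i4; rewrite [delta_mx _ _ _ _]mxE i4 mulr0.
Qed.

(** The two penalties with factor one half replace [- w . f] by minus half the
    sum of the mixed products, which cancel; only the heat datum is left. *)
Lemma wall_node_balance k : admissible (v k) ->
  - dot5 (w_int fl v k) (f_int C v Theta k)
  + dot5 (w_int fl v k) (pen_q fl C uw v Theta k + pen_heat g v k)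
  + dot5 (f_int C v Theta k) (pen_Theta fl uw v k) = g.
Proof.
move=> vk; rewrite dot5Dr dot_w_heat // /pen_q /pen_Theta !dot5Zr.
rewrite -(scaleN1r (f_bnd _ _ _ _ _ _)) -(scaleN1r (w_bnd _ _ _ _)).
rewrite !dot5Dr !dot5Zr.
rewrite !(dot5C (f_int _ _ _ _)).
have : dot5 (w_int fl v k) (f_bnd fl C uw v Theta k)
       + dot5 (w_bnd fl uw v k) (f_int C v Theta k) = 0.
  rewrite f_intE // f_bndE //; apply: mixed_products_cancel.
  - exact: tempE.
  - by move=> j; apply/funext => i; rewrite velE.
  - exact: tempE.
by lra.
Qed.

Lemma Xi_VE : (forall k, on_wall k -> admissible (v k)) ->
  Xi_V E fl C uw g v Theta = (\sum_(k | on_wall k) face_weight E ord0 k) * g.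
Proof.
move=> av; rewrite mulr_suml; apply: eq_bigr => k wk.
by rewrite wall_node_balance //; apply: av.
Qed.

End WallPenalty.

Theorem theorem3p2 (R : realType) (N : nat) (hN : (0 < N)%N)
    (E : element R N) (fl : fluid R)
    (C : 'I_3 -> 'I_3 -> 'cV[R]_5 -> 'M[R]_5) (hC : viscous_coefficients fl C)
    (tf : R) (htf : 0 < tf) :
  (forall (rem : remainder R N) (uw : R -> node N -> 'I_3 -> R) (g : R -> R)
      (v : R -> nodal_field R N) (Theta : R -> 'I_3 -> nodal_field R N),
      (forall t : R, t \in `[0, tf] -> g t = 0) ->
      numerical_solution E fl C rem tf uw g v Theta ->
      forall t : R, t \in `[0, tf] ->
        Xi_V E fl C (uw t) (g t) (v t) (Theta t) = 0)
  /\
  (exists F : R -> R,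
    forall (rem : remainder R N) (uw : R -> node N -> 'I_3 -> R) (g : R -> R)
      (v : R -> nodal_field R N) (Theta : R -> 'I_3 -> nodal_field R N),
      square_integrable tf g ->
      (exists2 t : R, t \in `[0, tf] & g t != 0) ->
      numerical_solution E fl C rem tf uw g v Theta ->
      forall t : R, t \in `[0, tf] ->
        Xi_V E fl C (uw t) (g t) (v t) (Theta t) = F (g t)).
Proof.
split=> [rem uw g v Theta g0 [adm _ _] t tI|].
  by rewrite (Xi_VE _ _ hC) ?g0 ?mulr0 // => k _; apply: adm.
exists (fun x => (\sum_(k : node N | on_wall k) face_weight E ord0 k) * x).
move=> rem uw g v Theta _ _ [adm _ _] t tI.
by rewrite (Xi_VE _ _ hC) // => k _; apply: adm.
Qed.
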